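(* Let $k$ be an algebraically closed field of characteristic zero and let $H=(1,m,\tau)$ be a numerical sequence (with $m,\tau$ positive integers). Then $H$ is the $h$-vector of an Artinian $2$-level local $k$-algebra if and only if $\tau\leqslant\binom{m+1}{2}$.
   Context: An Artinian local $k$-algebra $(A,\mathfrak m,k)$ here has residue field $k$. Its socle degree is the integer $s$ with $\mathfrak{m}^s\neq 0$ and $\mathfrak{m}^{s+1}=0$. It is $s$-level if $\mathrm{Soc}(A):=0:_A\mathfrak{m}=\mathfrak{m}^s$. The Hilbert function of $A$ is $HF_A(j)=\dim_k\mathfrak{m}^j/\mathfrak{m}^{j+1}$, and the $h$-vector of $A$ is $(HF_A(0),\ldots,HF_A(s))$, where $s$ is the socle degree of $A$. *)

(* Defs.v *)
From HB Require Import structures.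
From mathcomp Require Import all_boot all_order all_algebra.
From mathcomp Require Import boolp classical_sets.

Set Implicit Arguments.
Unset Strict Implicit.
Unset Printing Implicit Defensive.

Import GRing.Theory.

Local Open Scope classical_set_scope.
Local Open Scope ring_scope.

(* Ideals are Prop-valued sets, so that all ideals are considered and not only
   those with a boolean membership test (as in ring_quotient).  They are not
   required to be proper. *)
Section Ideals.

Variable A : comNzRingType.
Implicit Types I J M : set A.

Definition is_ideal I : Prop :=
  [/\ I 0,
      forall x y, I x -> I y -> I (x + y) &
      forall a x, I x -> I (a * x)].

Definition is_artinian : Prop :=
  forall I : nat -> set A,
    (forall n, is_ideal (I n)) ->
    (forall n, I n.+1 `<=` I n) ->
    exists N, forall n, (N <= n)%N -> I n = I N.

Definition is_maximal_ideal M : Prop :=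
  [/\ is_ideal M,
      M <> setT &
      forall I, is_ideal I -> M `<=` I -> I = M \/ I = setT].

Definition is_local M : Prop :=
  is_maximal_ideal M /\ forall N, is_maximal_ideal N -> N = M.

Definition ideal_mul I J : set A :=
  [set x | exists (n : nat) (a b : 'I_n -> A),
     [/\ forall i, I (a i), forall i, J (b i) & x = \sum_(i < n) a i * b i]].

Definition ideal_exp I (n : nat) : set A := iter n (ideal_mul I) setT.

Definition socle M : set A := [set x | forall y, M y -> x * y = 0].

Definition socle_degree M (s : nat) : Prop :=
  ideal_exp M s <> [set 0] /\ ideal_exp M s.+1 = [set 0].

Definition is_level M (s : nat) : Prop :=
  socle_degree M s /\ socle M = ideal_exp M s.

End Ideals.

Section LocalAlgebras.

Variables (k : fieldType) (A : comAlgType k).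
Implicit Types U V M : set A.

(* The structure map k -> A/M is bijective: every class modulo M contains
   exactly one scalar. *)
Definition residue_field_is_base M : Prop :=
  forall x : A, exists! c : k, M (x - c%:A).

Definition artinian_local_algebra M : Prop :=
  [/\ is_artinian A, is_local M & residue_field_is_base M].

(* dim_k (V / U) = d for k-subspaces U of V: the classes of some e_0, ...,
   e_(d-1) in V form a basis of V / U. *)
Definition quotient_dim V U (d : nat) : Prop :=
  exists2 e : 'I_d -> A,
    forall i, V (e i) &
    forall x, V x ->
      exists! c : 'rV[k]_d, U (x - \sum_(i < d) c ord0 i *: e i).

(* HF_A(j) = d *)
Definition hilbert_function M (j d : nat) : Prop :=
  quotient_dim (ideal_exp M j) (ideal_exp M j.+1) d.

Definition h_vector M (h : seq nat) : Prop :=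
  exists2 s : nat, socle_degree M s &
    size h = s.+1 /\
    forall j, (j <= s)%N -> hilbert_function M j (nth 0%N h j).

End LocalAlgebras.

(* Main.v *)
Require Import Defs.
From HB Require Import structures.
From mathcomp Require Import all_boot all_order all_algebra.
From mathcomp Require Import perm.
From mathcomp Require Import boolp classical_sets.
From mathcomp Require Import ring.

Set Implicit Arguments.
Unset Strict Implicit.
Unset Printing Implicit Defensive.

Import GRing.Theory.

Local Open Scope ring_scope.

(** Let M be the maximal ideal of a local algebra with h-vector (1, m, tau),
    so that M ^ 3 = 0.  If e_0, ..., e_(m-1) is a basis of M modulo M ^ 2, then
    a product x * y of elements of M depends only on the classes of x and y
    modulo M ^ 2, hence M ^ 2 is spanned by the products e_i * e_j.  By
    commutativity those with i <= j suffice; there are 'C(m + 1, 2) of them,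
    and tau = dim M ^ 2 is at most that number (h2_le, card_le_pair).

    Conversely, any family S_0, ..., S_(n-1) of symmetric m x m matrices over k
    defines a graded commutative algebra k + k^m + k^n: the product of two
    vectors u and v of degree one is the vector of the n values u S_t v^T, and
    products of total degree above two vanish.  It is local, artinian because
    it is finite dimensional, with maximal ideal M = k^m + k^n.  The ideal M ^ 2
    is spanned by the values of a bilinear map, and it is all of k^n exactly
    when no nontrivial linear form kills those values, which is the linear
    independence of the S_t (forms_alg_exp2).  The socle is k^n as soon as no
    nonzero vector is in the radical of every S_t (forms_alg_level).

    It remains to find tau independent symmetric matrices without common
    radical (exists_level_forms).  Having S_0 invertible disposes of the
    radical: take S_0 to be the identity, and for the others the elementary
    symmetric matrices attached to pairs i <= j other than (0, 0). *)

(** * The upper bound on the second Hilbert value *)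

Section IdealPowers.
Variables (A : comNzRingType) (M : set A).
Hypothesis idM : is_ideal M.

Lemma ideal_exp1 : ideal_exp M 1 = M.
Proof.
have [M0 MD MM] := idM; apply/seteqP; split=> x /=.
  case=> n [a [b [Ma _ ->]]]; apply: (big_ind M) => // i _.
  by rewrite mulrC; apply: MM.
move=> Mx; exists 1%N, (fun=> x), (fun=> 1); split=> //.
by rewrite big_ord1 mulr1.
Qed.

Lemma ideal_exp_mul i x y :
  M x -> ideal_exp M i y -> ideal_exp M i.+1 (x * y).
Proof.
move=> Mx Ey; exists 1%N, (fun=> x), (fun=> y); split=> //.
by rewrite big_ord1.
Qed.

End IdealPowers.

Local Notation le_pair m := {p : 'I_m * 'I_m | (p.1 <= p.2)%N}.

Section Counting.
Variables (k : fieldType) (A : comAlgType k).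

(** Writing the basis of V / U through the generators and the generators
    through the basis gives two matrices whose product is, by uniqueness of
    coordinates, the identity of size d; hence d <= N. *)
Lemma quotient_dim_le (V U : set A) (d N : nat) (g : 'I_N -> A) :
    U 0 -> (forall x y, U x -> U y -> U (x + y)) ->
    (forall a x, U x -> U (a *: x)) ->
    (forall p, V (g p)) ->
    (forall x, V x -> exists c : 'rV[k]_N, U (x - \sum_p c 0 p *: g p)) ->
  quotient_dim V U d -> (d <= N)%N.
Proof.
move=> U0 UD UZ Vg gen [e Ve eU].
have [P PE] := choice (fun t => gen _ (Ve t)).
have [Q QE] := choice (fun p => eU _ (Vg p)).
apply: (@mulmx1_min _ _ _ (\matrix_t P t) (\matrix_p Q p)).
apply/row_matrixP => t; have [? [_ c_uniq]] := eU _ (Ve t).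
rewrite row1 -(c_uniq (delta_mx 0 t)); first (symmetry; apply: c_uniq).
  have -> : e t - \sum_s row t (\matrix_t P t *m \matrix_p Q p) 0 s *: e s =
      (e t - \sum_p P t 0 p *: g p)
      + \sum_p P t 0 p *: (g p - \sum_s Q p 0 s *: e s).
    under [X in _ = _ + X]eq_bigr do rewrite scalerBr scaler_sumr.
    rewrite sumrB addrA subrK exchange_big; congr (_ - _).
    apply: eq_bigr => s _; rewrite !mxE scaler_suml.
    by apply: eq_bigr => p _; rewrite !mxE scalerA.
  apply: (UD) => //; apply: (big_ind U) => // p _; apply: UZ.
  by have [] := QE p.
rewrite (bigD1 t) //= !mxE !eqxx scale1r big1 ?addr0 ?subrr // => s.
by rewrite mxE eqxx /= => /negPf->; rewrite scale0r.
Qed.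

Lemma card_le_pair m : #|{: le_pair m}| = 'C(m.+1, 2).
Proof.
rewrite card_sig -sum1_card.
rewrite (eq_bigl (fun p : 'I_m * 'I_m => (p.1 <= p.2)%N)) //.
rewrite -(pair_big_dep xpredT (fun i j : 'I_m => (i <= j)%N) (fun _ _ => 1%N)).
rewrite (exchange_big_dep xpredT) //= -bin2_sum big_mkord big_ord_recl add0n.
apply: eq_bigr => j _.
by rewrite (big_ord_narrow (ltn_ord j)) sum1_card card_ord.
Qed.

Variable M : set A.

(** The second value of the Hilbert function is bounded by the number of
    quadratic monomials in the generators, because M ^ 3 = 0 makes M ^ 2 the
    span of products of representatives of a basis of M / M ^ 2. *)
Lemma h2_le m tau : is_ideal M -> ideal_exp M 3 = [set 0]%classic ->
  hilbert_function M 1 m -> hilbert_function M 2 tau ->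
  (tau <= #|{: le_pair m}|)%N.
Proof.
move=> idM M3 [e]; rewrite ideal_exp1 // => Me eU M2.
have [M0 MD MM] := idM.
have mul0 x y : M x -> ideal_exp M 2 y -> x * y = 0.
  by move=> Mx M2y; have := ideal_exp_mul Mx M2y; rewrite M3.
pose g (p : 'I_#|{: le_pair m}|) :=
  let q := sval (enum_val p) in e q.1 * e q.2.
have MMe i j : ideal_exp M 2 (e i * e j).
  by apply: ideal_exp_mul => //; rewrite ideal_exp1.
pose gspan x := exists c : 'rV[k]_#|{: le_pair m}|, x = \sum_p c 0 p *: g p.
have span0 : gspan 0.
  by exists 0; rewrite big1 // => p _; rewrite mxE scale0r.
have spanD x y : gspan x -> gspan y -> gspan (x + y).
  move=> [c ->] [c' ->]; exists (c + c'); rewrite -big_split /=.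
  by apply: eq_bigr => p _; rewrite mxE scalerDl.
have spanZ a x : gspan x -> gspan (a *: x).
  move=> [c ->]; exists (a *: c); rewrite scaler_sumr.
  by apply: eq_bigr => p _; rewrite mxE scalerA.
have span_le (i j : 'I_m) (le_ij : (i <= j)%N) : gspan (e i * e j).
  pose q : le_pair m := exist _ (i, j) le_ij.
  exists (delta_mx 0 (enum_rank q)).
  rewrite (bigD1 (enum_rank q)) //= mxE !eqxx scale1r.
  rewrite big1 ?addr0 /g ?enum_rankK // => p /negPf.
  by rewrite mxE eqxx /= => ->; rewrite scale0r.
have span_e i j : gspan (e i * e j).
  by have [|/ltnW] := leqP i j; [|rewrite mulrC]; apply: span_le.
have span_mul x y : M x -> M y -> gspan (x * y).
  move=> Mx My.
  have [c [M2x _]] := eU _ Mx; have [c' [M2y _]] := eU _ My.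
  set x' := \sum_i c 0 i *: e i in M2x; set y' := \sum_i c' 0 i *: e i in M2y.
  have sumM (b : 'rV_m) : M (\sum_i b 0 i *: e i).
    apply: (big_ind M) => // i _; rewrite -mulr_algl; exact: MM.
  (* M * M ^ 2 = 0, so x and y may be replaced by their linear parts. *)
  have -> : x * y = x' * y'.
    have /eqP := mul0 _ _ My M2x; rewrite mulrC mulrBl subr_eq0 => /eqP->.
    by have /eqP := mul0 _ _ (sumM c) M2y; rewrite mulrBr subr_eq0 => /eqP->.
  rewrite mulr_suml; apply: (big_ind gspan) => // i _.
  rewrite -scalerAl mulr_sumr; apply: (spanZ); apply: (big_ind gspan) => // j _.
  by rewrite -scalerAr; apply: spanZ.
apply: (quotient_dim_le _ _ _ _ _ M2 (g := g)).
- by rewrite M3.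
- by rewrite M3 => x y -> ->; rewrite addr0.
- by rewrite M3 => a x ->; rewrite scaler0.
- by move=> p; apply: MMe.
move=> x M2x; suff [c ->] : gspan x by exists c; rewrite subrr M3.
case: M2x => n [a [b [Ma Mb ->]]]; apply: (big_ind gspan) => // i _.
have : ideal_exp M 1 (b i) by apply: Mb.
by rewrite ideal_exp1 //; apply: span_mul.
Qed.

End Counting.

(** * Descending chains in a finite-dimensional space *)

Section Artinian.
Variables (k : fieldType) (V : vectType k).

Definition linear_set (I : set V) : Prop :=
  [/\ I 0, forall x y, I x -> I y -> I (x + y) & forall a x, I x -> I (a *: x)].

(** A subspace of largest dimension among those contained in I is all of I:
    adding to it the line through a point of I cannot raise the dimension.
    This lets the dimension argument apply to ideals with no membership
    test. *)
Lemma linear_set_vspace (I : set V) :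
  linear_set I -> exists U : {vspace V}, I = [set x | x \in U]%classic.
Proof.
move=> [I0 ID IZ].
pose P d := `[< exists2 U : {vspace V}, {in U, forall x, I x} & \dim U = d >].
have exP : exists d, P d.
  exists 0%N; apply/asboolP; exists 0%VS; last exact: dimv0.
  by move=> x /[!memv0] /eqP->.
have boundP d : P d -> (d <= \dim {:V})%N.
  by case/asboolP => U _ <-; rewrite dimvS ?subvf.
case: (ex_maxnP exP boundP) => d /asboolP[U UI dimU] d_max.
exists U; apply/seteqP; split=> x /= => [Ix|]; last exact: UI.
have le_dim : (\dim (U + <[x]>) <= \dim U)%N.
  rewrite dimU; apply: d_max; apply/asboolP; exists (U + <[x]>)%VS => // y.
  by case/memv_addP=> u /UI Iu [_ /vlineP[a ->] ->]; apply: ID; last apply: IZ.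
have /eqP -> : U == (U + <[x]>)%VS by rewrite eqEdim addvSl le_dim.
by rewrite memvE addvSr.
Qed.

Lemma linear_set_dcc (I : nat -> set V) :
    (forall n, linear_set (I n)) -> (forall n, I n.+1 `<=` I n)%classic ->
  exists N, forall n, (N <= n)%N -> I n = I N.
Proof.
move=> linI decI.
have [U IU] := choice (fun n => linear_set_vspace (linI n)).
have decU n N : (N <= n)%N -> (U n <= U N)%VS.
  move=> /subnK <-; elim: (n - N)%N => [|i IHi] //=.
  apply: subv_trans IHi; apply/subvP => x xU.
  by have /= := decI (i + N)%N x; rewrite !IU /=; apply.
pose P d := `[< exists n, \dim (U n) = d >].
have exP : exists d, P d by exists (\dim (U 0%N)); apply/asboolP; exists 0%N.
case: (ex_minnP exP) => d /asboolP[N dimN] d_min.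
exists N => n leNn; rewrite !IU; suff /eqP-> : U n == U N by [].
rewrite eqEdim decU //= dimN; apply: d_min; apply/asboolP; by exists n.
Qed.

End Artinian.

(** * The algebra of a family of symmetric matrices *)

Section FormProduct.
Variables (k : fieldType) (m n : nat) (S : 'I_n -> 'M[k]_m).
Implicit Types (a : k) (u v w : 'rV[k]_m).

Definition forms_prod u v : 'rV[k]_n := \row_t (u *m S t *m v^T) 0 0.

Lemma forms_prodE u v t : forms_prod u v 0 t = (u *m S t *m v^T) 0 0.
Proof. by rewrite mxE. Qed.

Lemma forms_prodDl u v w :
  forms_prod (u + v) w = forms_prod u w + forms_prod v w.
Proof. by apply/rowP => t; rewrite [RHS]mxE !forms_prodE !mulmxDl mxE. Qed.

Lemma forms_prod0l v : forms_prod 0 v = 0.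
Proof. by apply/rowP => t; rewrite forms_prodE !mul0mx !mxE. Qed.

Lemma forms_prodZl a u v : forms_prod (a *: u) v = a *: forms_prod u v.
Proof. by apply/rowP => t; rewrite [RHS]mxE !forms_prodE -!scalemxAl mxE. Qed.

Lemma forms_prod_delta i j t :
  forms_prod (delta_mx 0 i) (delta_mx 0 j) 0 t = S t i j.
Proof. by rewrite forms_prodE trmx_delta -rowE -colE !mxE. Qed.

Hypothesis symS : forall t, (S t)^T = S t.

Lemma forms_prodC u v : forms_prod u v = forms_prod v u.
Proof.
apply/rowP => t; rewrite !forms_prodE -[in LHS](trmxK (u *m _ *m _)) mxE.
by rewrite !trmx_mul trmxK symS mulmxA.
Qed.

Lemma forms_prodDr u v w :
  forms_prod u (v + w) = forms_prod u v + forms_prod u w.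
Proof. by rewrite !(forms_prodC u) forms_prodDl. Qed.

Lemma forms_prod0r u : forms_prod u 0 = 0.
Proof. by rewrite forms_prodC forms_prod0l. Qed.

Lemma forms_prodZr a u v : forms_prod u (a *: v) = a *: forms_prod u v.
Proof. by rewrite !(forms_prodC u) forms_prodZl. Qed.

End FormProduct.

Section Algebra.

Variables (k : fieldType) (m n : nat) (S : 'I_n -> 'M[k]_m).
Hypothesis symS : forall t, (S t)^T = S t.

(** The proof of symmetry is a parameter of the type so that the commutative
    ring structure can be attached to the type itself. *)
Definition forms_alg of (forall t, (S t)^T = S t) : Type :=
  (k^o * ('rV[k]_m * 'rV[k]_n))%type.

Local Notation A := (forms_alg symS).
Local Notation B := (forms_prod S).

HB.instance Definition _ := Vector.on A.

Definition graded (a : k) (v : 'rV[k]_m) (w : 'rV[k]_n) : A := (a, (v, w)).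
Definition deg0 (x : A) : k := x.1.
Definition deg1 (x : A) : 'rV[k]_m := x.2.1.
Definition deg2 (x : A) : 'rV[k]_n := x.2.2.

Definition forms_alg_mul (x y : A) : A :=
  graded (deg0 x * deg0 y)
    (deg0 x *: deg1 y + deg0 y *: deg1 x)
    (deg0 x *: deg2 y + deg0 y *: deg2 x + B (deg1 x) (deg1 y)).

Lemma gradedP x y :
  deg0 x = deg0 y -> deg1 x = deg1 y -> deg2 x = deg2 y -> x = y.
Proof.
by case: x y => [a [v w]] [b [v' w']]; rewrite /deg0 /deg1 /deg2 /= => -> -> ->.
Qed.

(** These rules speak of the product and not of [graded]: a rule for [graded]
    would also apply to a sum, which unfolds to the same pair. *)
Lemma deg0_mul x y : deg0 (forms_alg_mul x y) = deg0 x * deg0 y.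
Proof. by []. Qed.
Lemma deg1_mul x y :
  deg1 (forms_alg_mul x y) = deg0 x *: deg1 y + deg0 y *: deg1 x.
Proof. by []. Qed.
Lemma deg2_mul x y : deg2 (forms_alg_mul x y) =
  deg0 x *: deg2 y + deg0 y *: deg2 x + B (deg1 x) (deg1 y).
Proof. by []. Qed.
Definition deg_mul := (deg0_mul, deg1_mul, deg2_mul).

Lemma forms_alg_mulA : associative forms_alg_mul.
Proof.
move=> x y z; apply: gradedP; rewrite !deg_mul.
- by rewrite mulrA.
- by apply/rowP=> i; rewrite !mxE; ring.
rewrite forms_prodDl forms_prodDr // !forms_prodZl !forms_prodZr //.
move: (B _ _) (B _ _) (B _ _) => b1 b2 b3.
by apply/rowP=> i; rewrite !mxE; ring.
Qed.

Lemma forms_alg_mulC : commutative forms_alg_mul.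
Proof.
move=> x y; apply: gradedP; rewrite !deg_mul.
- by rewrite mulrC.
- by rewrite addrC.
by rewrite forms_prodC // [X in X + _]addrC.
Qed.

Lemma forms_alg_mul1 : left_id (graded 1 0 0) forms_alg_mul.
Proof.
move=> x; apply: gradedP; rewrite deg_mul.
- by rewrite mul1r.
- by rewrite scale1r scaler0 addr0.
by rewrite forms_prod0l scale1r scaler0 !addr0.
Qed.

Lemma deg0D x y : deg0 (x + y) = deg0 x + deg0 y. Proof. by []. Qed.
Lemma deg1D x y : deg1 (x + y) = deg1 x + deg1 y. Proof. by []. Qed.
Lemma deg2D x y : deg2 (x + y) = deg2 x + deg2 y. Proof. by []. Qed.
Definition degD := (deg0D, deg1D, deg2D).

Lemma deg0Z a x : deg0 (a *: x) = a * deg0 x. Proof. by []. Qed.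
Lemma deg1Z a x : deg1 (a *: x) = a *: deg1 x. Proof. by []. Qed.
Lemma deg2Z a x : deg2 (a *: x) = a *: deg2 x. Proof. by []. Qed.
Definition degZ := (deg0Z, deg1Z, deg2Z).

Lemma forms_alg_mulDl : left_distributive forms_alg_mul +%R.
Proof.
move=> x y z; apply: gradedP; rewrite degD !deg_mul !degD.
- by rewrite mulrDl.
- by apply/rowP=> i; rewrite !mxE; ring.
rewrite forms_prodDl.
move: (B _ _) (B _ _) => b1 b2.
by apply/rowP=> i; rewrite !mxE; ring.
Qed.

Lemma forms_alg_1neq0 : graded 1 0 0 != 0.
Proof. by apply/eqP => /(congr1 deg0) /eqP; rewrite oner_eq0. Qed.

HB.instance Definition _ := GRing.Zmodule_isComNzRing.Build A
  forms_alg_mulA forms_alg_mulC forms_alg_mul1 forms_alg_mulDl forms_alg_1neq0.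

Lemma deg0M (x y : A) : deg0 (x * y) = deg0 x * deg0 y.
Proof. by []. Qed.
Lemma deg1M (x y : A) : deg1 (x * y) = deg0 x *: deg1 y + deg0 y *: deg1 x.
Proof. by []. Qed.
Lemma deg2M (x y : A) :
  deg2 (x * y) = deg0 x *: deg2 y + deg0 y *: deg2 x + B (deg1 x) (deg1 y).
Proof. by []. Qed.
Definition degM := (deg0M, deg1M, deg2M).

Lemma forms_alg_scalerAl a (x y : A) : a *: (x * y) = (a *: x) * y.
Proof.
apply: gradedP; rewrite degZ !degM !degZ.
- by rewrite mulrA.
- by apply/rowP=> i; rewrite !mxE; ring.
rewrite forms_prodZl; move: (B _ _) => b.
by apply/rowP=> i; rewrite !mxE; ring.
Qed.

HB.instance Definition _ := GRing.Lmodule_isLalgebra.Build k A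
  forms_alg_scalerAl.
HB.instance Definition _ := GRing.Lalgebra_isComAlgebra.Build k A.

End Algebra.

(** * Local structure, socle and Hilbert function *)

Section Level.

Variables (k : fieldType) (m n : nat) (S : 'I_n -> 'M[k]_m).
Hypothesis symS : forall t, (S t)^T = S t.

Local Notation A := (forms_alg symS).
Local Notation B := (forms_prod S).
Local Notation graded := (graded symS).

Definition forms_alg_max : set A := [set x | deg0 x = 0]%classic.
Definition forms_alg_sq : set A := [set x | deg0 x = 0 /\ deg1 x = 0]%classic.
Local Notation M := forms_alg_max.

Lemma forms_alg_maxE x : M x = (deg0 x = 0). Proof. by []. Qed.

Lemma deg0B (x y : A) : deg0 (x - y) = deg0 x - deg0 y. Proof. by []. Qed.
Lemma deg1B (x y : A) : deg1 (x - y) = deg1 x - deg1 y. Proof. by []. Qed.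
Lemma deg2B (x y : A) : deg2 (x - y) = deg2 x - deg2 y. Proof. by []. Qed.

Lemma deg0_sum I (r : seq I) (F : I -> A) :
  deg0 (\sum_(i <- r) F i) = \sum_(i <- r) deg0 (F i).
Proof. exact: (big_morph _ (@deg0D _ _ _ _ symS)). Qed.
Lemma deg1_sum I (r : seq I) (F : I -> A) :
  deg1 (\sum_(i <- r) F i) = \sum_(i <- r) deg1 (F i).
Proof. exact: (big_morph _ (@deg1D _ _ _ _ symS)). Qed.
Lemma deg2_sum I (r : seq I) (F : I -> A) :
  deg2 (\sum_(i <- r) F i) = \sum_(i <- r) deg2 (F i).
Proof. exact: (big_morph _ (@deg2D _ _ _ _ symS)). Qed.

Lemma forms_alg_max_ideal : is_ideal M.
Proof.
split=> [|x y|a x] //; rewrite !forms_alg_maxE.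
  by rewrite deg0D => -> ->; rewrite addr0.
by rewrite deg0M => ->; rewrite mulr0.
Qed.

(** An element with nonzero constant term is invertible: after normalising
    that term to 1 it has the form 1 - z with z ^ 3 = 0. *)
Lemma ideal_not_sub_max (I : set A) :
  is_ideal I -> ~ (I `<=` M)%classic -> I = setT.
Proof.
move=> [I0 ID IM] nIM.
have [x Ix x_unit] : exists2 x, I x & deg0 x != 0.
  apply: contrapT => nx; apply: nIM => x Ix; apply: contrapT => /eqP x0.
  by apply: nx; exists x.
suff I1 : I 1 by apply/seteqP; split=> // y _; rewrite -(mulr1 y); apply: IM.
pose y : A := graded (deg0 x)^-1 0 0 * x; have Iy : I y by apply: IM.
have y0 : deg0 y = 1 by rewrite deg0M mulVf.
pose z := 1 - y; have z0 : deg0 z = 0 by rewrite deg0B y0 subrr.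
have z3 : z * z * z = 0.
  apply: gradedP.
  - by rewrite !deg0M z0 !mul0r.
  - by rewrite deg1M !deg0M !deg1M z0 !(mul0r, scale0r, addr0).
  rewrite deg2M !deg0M !deg1M z0 !(mul0r, scale0r, addr0, add0r).
  by rewrite forms_prod0l.
have <- : (1 + z + z * z) * y = 1.
  have -> : y = 1 - z by rewrite opprB addrC subrK.
  move: z z3 {z0} => z z3.
  rewrite mulrBr mulr1 !mulrDl mul1r z3 addr0.
  by rewrite -[1 + z + _]addrA addrK.
exact: IM.
Qed.

Lemma forms_alg_max_neqT : M <> setT.
Proof.
move=> MT; have : M 1 by rewrite MT.
by move/eqP; rewrite oner_eq0.
Qed.

Lemma forms_alg_local : is_local M.
Proof.
split=> [|N [idN NT maxN]].
  split; [exact: forms_alg_max_ideal | exact: forms_alg_max_neqT |].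
  move=> I idI MI.
  have [IM|/ideal_not_sub_max ->//] := pselect (I `<=` M)%classic.
    by left; apply/seteqP.
  by right.
have NM : (N `<=` M)%classic.
  by apply: contrapT => /ideal_not_sub_max - /(_ idN).
by case: (maxN M forms_alg_max_ideal NM) => // /forms_alg_max_neqT.
Qed.

Lemma forms_alg_artinian : is_artinian A.
Proof.
move=> I idI; apply: (@linear_set_dcc k A) => i.
have [I0 ID IM] := idI i; split=> // a x Ix.
by rewrite -mulr_algl; apply: IM.
Qed.

Lemma forms_alg_residue : residue_field_is_base M.
Proof.
move=> x; exists (deg0 x); split=> [|c].
  by rewrite forms_alg_maxE deg0B deg0Z mulr1 subrr.
by rewrite forms_alg_maxE deg0B deg0Z mulr1 => /eqP; rewrite subr_eq0 => /eqP.
Qed.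

Lemma forms_alg_artinian_local : artinian_local_algebra M.
Proof.
split; [exact: forms_alg_artinian | exact: forms_alg_local |].
exact: forms_alg_residue.
Qed.

Hypothesis indepS :
  forall c : 'rV[k]_n, \sum_t c 0 t *: S t = 0 -> c = 0.

(** The matrix Q whose row t lists the entries of S_t is row free by
    independence, so it has a right inverse; this inverse produces, for a
    prescribed w of degree two, coefficients g_ij with
    w = sum_ij (g_ij e_i) * e_j. *)
Lemma forms_alg_exp2 : ideal_exp M 2 = forms_alg_sq.
Proof.
rewrite /ideal_exp iterS -/(ideal_exp M 1) ideal_exp1;
  last exact: forms_alg_max_ideal.
apply/seteqP; split=> x /=.
  case=> N [a [b [Ma Mb ->]]]; split.
    rewrite deg0_sum big1 // => i _.
    by rewrite deg0M Ma mul0r.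
  rewrite deg1_sum big1 // => i _.
  by rewrite deg1M Ma Mb !scale0r addr0.
case=> x0 x1.
pose P : finType := ('I_m * 'I_m)%type.
pose Q : 'M[k]_(n, #|P|) :=
  \matrix_(t, p) S t (enum_val p).1 (enum_val p).2.
have /row_freeP[Q' QQ'] : row_free Q.
  apply: inj_row_free => c cQ; apply: indepS; apply/matrixP => i j.
  have /rowP/(_ (enum_rank (i, j))) := cQ; rewrite !mxE => <-.
  rewrite summxE; apply: eq_bigr => t _.
  by rewrite !mxE enum_rankK.
pose g := Q' *m (deg2 x)^T.
exists #|P|, (fun p => graded 0 (g p 0 *: delta_mx 0 (enum_val p).1) 0),
  (fun p => graded 0 (delta_mx 0 (enum_val p).2) 0); split=> //.
apply: gradedP.
- by rewrite x0 deg0_sum big1 // => p _; rewrite deg0M mul0r.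
- by rewrite x1 deg1_sum big1 // => p _; rewrite deg1M !scale0r addr0.
rewrite deg2_sum; apply/rowP => t.
have -> : deg2 x 0 t = (Q *m g) t 0 by rewrite mulmxA QQ' mul1mx mxE.
rewrite summxE mxE; apply: eq_bigr => p _.
rewrite deg2M !scale0r !add0r /deg1 /= forms_prodZl.
rewrite [RHS]mxE forms_prod_delta mulrC.
by congr (_ * _); rewrite mxE.
Qed.

Lemma forms_alg_exp3 : ideal_exp M 3 = [set 0]%classic.
Proof.
rewrite /ideal_exp iterS -/(ideal_exp M 2) forms_alg_exp2.
apply/seteqP; split=> x /=.
  case=> N [a [b [Ma Mb ->]]]; rewrite big1 // => i _.
  have [b0 b1] := Mb i.
  apply: gradedP; first by rewrite deg0M Ma mul0r.
    by rewrite deg1M Ma b0 !scale0r addr0.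
  rewrite deg2M Ma b0 b1 !scale0r !add0r.
  by rewrite forms_prod0r.
move=> ->; exists 0%N, (fun=> 0), (fun=> 0); split=> //.
by rewrite big_ord0.
Qed.

Hypothesis nondegS : forall v : 'rV[k]_m, (forall t, v *m S t = 0) -> v = 0.
Hypothesis n_gt0 : (0 < n)%N.

Lemma forms_alg_socle_degree : socle_degree M 2.
Proof.
split; last exact: forms_alg_exp3.
rewrite forms_alg_exp2 => sq0.
have : forms_alg_sq (graded 0 0 (const_mx 1)) by [].
rewrite sq0 => /(congr1 (@deg2 _ _ _ _ symS)) /rowP/(_ (Ordinal n_gt0)) /eqP.
by rewrite !mxE oner_eq0.
Qed.

(** A socle element x has no constant term, as it kills k^n, which is
    nonzero; its degree-one part lies in the radical of every S_t, as x kills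
    k^m. *)
Lemma forms_alg_level : is_level M 2.
Proof.
split; first exact: forms_alg_socle_degree.
rewrite forms_alg_exp2; apply/seteqP; split=> x /=; last first.
  move=> [x0 x1] y; rewrite forms_alg_maxE => y0; apply: gradedP.
  - by rewrite deg0M x0 mul0r.
  - by rewrite deg1M x0 y0 !scale0r addr0.
  rewrite deg2M x0 y0 x1 !scale0r !add0r.
  by rewrite forms_prod0l.
move=> socx; have x0 : deg0 x = 0.
  have := socx (graded 0 0 (const_mx 1)) erefl.
  move/(congr1 (@deg2 _ _ _ _ symS)).
  rewrite deg2M scale0r addr0 forms_prod0r // addr0.
  by move=> /rowP/(_ (Ordinal n_gt0)); rewrite !mxE mulr1.
split=> //; apply: nondegS => t; apply/rowP => j.
have := socx (graded 0 (delta_mx 0 j) 0) erefl.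
move/(congr1 (@deg2 _ _ _ _ symS)).
rewrite deg2M x0 !scale0r !add0r => /rowP/(_ t).
by rewrite forms_prodE trmx_delta -colE !mxE.
Qed.

Lemma forms_alg_h_vector : h_vector M [:: 1%N; m; n].
Proof.
exists 2%N; first exact: forms_alg_socle_degree.
split=> // -[|[|[|//]]] _; rewrite /hilbert_function /=.
- exists (fun=> 1) => // x _; exists (const_mx (deg0 x)).
  rewrite -[ideal_mul M _]/(ideal_exp M 1) ideal_exp1;
    last exact: forms_alg_max_ideal.
  split=> [|c]; rewrite forms_alg_maxE.
    by rewrite big_ord1 deg0B deg0Z mxE mulr1 subrr.
  rewrite big_ord1 deg0B deg0Z mulr1 => /eqP; rewrite subr_eq0 => /eqP ->.
  by apply/rowP => i; rewrite mxE [i]ord1.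
- change (quotient_dim (ideal_exp M 1) (ideal_exp M 2) m).
  rewrite forms_alg_exp2 ideal_exp1; last exact: forms_alg_max_ideal.
  exists (fun i => graded 0 (delta_mx 0 i) 0) => // x x0; exists (deg1 x).
  have E (c : 'rV[k]_m) :
     let y := \sum_i c ord0 i *: graded 0 (delta_mx 0 i) 0 in
     (deg0 y = 0) * (deg1 y = c).
    move=> y; split; rewrite (deg0_sum, deg1_sum).
      by rewrite big1 // => i _; rewrite deg0Z mulr0.
    by rewrite [RHS]row_sum_delta; apply: eq_bigr.
  split=> [|c []].
    by split; rewrite ?deg0B ?deg1B !E ?x0 !subrr.
  by rewrite deg1B E => _ /eqP; rewrite subr_eq0 => /eqP.
change (quotient_dim (ideal_exp M 2) (ideal_exp M 3) n).
rewrite forms_alg_exp3 forms_alg_exp2.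
exists (fun i => graded 0 0 (delta_mx 0 i)) => // x [x0 x1]; exists (deg2 x).
have E (c : 'rV[k]_n) :
    let y := \sum_i c ord0 i *: graded 0 0 (delta_mx 0 i) in
    ((deg0 y = 0) * (deg1 y = 0) * (deg2 y = c))%type.
  move=> y; split; first split; rewrite (deg0_sum, deg1_sum, deg2_sum).
  - by rewrite big1 // => i _; rewrite deg0Z mulr0.
  - by rewrite big1 // => i _; rewrite deg1Z scaler0.
  by rewrite [RHS]row_sum_delta; apply: eq_bigr.
split=> [|c /= /eqP].
  apply: gradedP; first by rewrite deg0B E x0 subrr.
    by rewrite deg1B E x1 subrr.
  by rewrite deg2B E subrr.
by rewrite subr_eq0 => /eqP->; rewrite E.
Qed.

End Level.

(** * A family of forms for every admissible size *)

Section LevelForms.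
Variable (k : fieldType).

(** The pairs i <= j are listed with (0, 0) first.  Evaluating a linear relation
    at (0, 0) sees only S_0, so the coefficient of S_0 vanishes; evaluating it
    at the s-th pair then sees only S_s.  The matrix of
    a pair (i, j) is the indicator of {(i, j), (j, i)} and not E_ij + E_ji,
    whose entry 2 for i = j would vanish in characteristic two. *)
Lemma exists_level_forms m n : (0 < m)%N -> (0 < n <= 'C(m.+1, 2))%N ->
  exists S : 'I_n -> 'M[k]_m,
    [/\ forall t, (S t)^T = S t,
        forall c : 'rV[k]_n, \sum_t c 0 t *: S t = 0 -> c = 0 &
        forall v : 'rV_m, (forall t, v *m S t = 0) -> v = 0].
Proof.
case: m n => // m [|n] // _; rewrite -card_le_pair => /= le_n.
pose T := le_pair m.+1.
pose o : T := exist _ (ord0, ord0) (leqnn 0).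
pose f0 (t : 'I_n.+1) : T := enum_val (widen_ord le_n t).
(* The transposition moves the pair (0, 0) to position 0. *)
pose f t := tperm (f0 ord0) o (f0 t).
have f_inj : injective f.
  by move=> t t' /perm_inj /enum_val_inj /(congr1 val) /= /val_inj.
have f_0 : f ord0 = o by rewrite /f tpermL.
pose S t : 'M[k]_m.+1 := if t == ord0 then 1%:M else
  \matrix_(i, j) (((i, j) == sval (f t)) || ((j, i) == sval (f t)))%:R.
have S_f s t : t != ord0 -> S t (sval (f s)).1 (sval (f s)).2 = (t == s)%:R.
  move=> /negPf t0; rewrite /S t0 mxE -surjective_pairing.
  congr (nat_of_bool _)%:R.
  rewrite (inj_eq val_inj) (inj_eq f_inj) [s == t]eq_sym.
  have [//|ts] := eqVneq t s; apply/negP => /eqP Ets; move: ts.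
  (* The s-th pair is the reversal of the t-th one; as both are increasing,
     they lie on the diagonal and coincide. *)
  have := valP (f s); have := valP (f t); rewrite /= -Ets /= => le1 le2.
  case/eqP; apply: f_inj; apply: val_inj; rewrite /= -Ets.
  rewrite [RHS]surjective_pairing; suff -> : (sval (f s)).1 = (sval (f s)).2.
    by [].
  by apply: val_inj; apply/eqP; rewrite eqn_leq le1 le2.
have S_f0 t : t != ord0 -> S t ord0 ord0 = 0.
  by move=> t0; have := S_f ord0 t t0; rewrite f_0 (negPf t0).
exists S; split.
- move=> t; rewrite /S; case: eqP => _; first exact: trmx1.
  by apply/matrixP => i j; rewrite !mxE orbC.
- move=> c c0; have c_0 : c 0 ord0 = 0.
    have := congr1 (fun X : 'M_m.+1 => X ord0 ord0) c0.
    rewrite summxE (bigD1 ord0) //= big1 => [|t t0].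
      by rewrite /S eqxx !mxE mulr1 addr0.
    by rewrite mxE S_f0 // mulr0.
  apply/rowP => s; rewrite [RHS]mxE; have [-> //|s0] := eqVneq s ord0.
  have := congr1 (fun X : 'M_m.+1 => X (sval (f s)).1 (sval (f s)).2) c0.
  rewrite summxE (bigD1 s) //= big1 => [|t ts].
    by rewrite !mxE S_f // eqxx mulr1 addr0.
  have [->|t0] := eqVneq t ord0; first by rewrite c_0 scale0r mxE.
  by rewrite mxE S_f // (negPf ts) mulr0.
by move=> v /(_ ord0); rewrite /S eqxx mulmx1.
Qed.

End LevelForms.

Theorem proposition4p1 (k : closedFieldType) (k_char0 : [pchar k] =i pred0)
    (m tau : nat) (m_gt0 : (0 < m)%N) (tau_gt0 : (0 < tau)%N) :
  (exists (A : comAlgType k) (M : set A),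
     [/\ artinian_local_algebra M,
         is_level M 2 &
         h_vector M [:: 1%N; m; tau]])
  <-> (tau <= 'C(m.+1, 2))%N.
Proof.
split=> [[A [M [[_ [[idM _ _] _] _] _]]]|le_tau].
  case=> s [_ Ms] [[Es]]; move: s Es Ms => _ <- Ms hilbM.
  rewrite -card_le_pair.
  by apply: (h2_le idM Ms); [exact: (hilbM 1%N) | exact: (hilbM 2%N)].
have [||S [symS indepS nondegS]] := @exists_level_forms k m tau.
- by [].
- by rewrite tau_gt0.
exists (forms_alg symS), (@forms_alg_max _ _ _ _ symS); split.
- exact: forms_alg_artinian_local.
- exact: forms_alg_level.
exact: forms_alg_h_vector.
Qed.
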